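(* Let $n\ge3$ be odd and let the eigenspaces of the cycle graph $C_n$ be in frequency order. Then every minimal positively weighted extremal design of $C_n$ consists of $n-2$ vertices.
   Context: $C_n$ is the cycle graph on $n$ vertices. For a connected $\delta$-regular graph $G$ on $n$ vertices with adjacency matrix $A$, eigenvalues and eigenspaces mean those of $\frac1\delta A$. Frequency order means that eigenspaces $\Lambda_1<\cdots<\Lambda_m$ are ordered by decreasing absolute value of the eigenvalue, with $\Lambda_1=\operatorname{span}\{\mathbb{1}\}$ (eigenvalue $1$) first. A vertex subset $W$ with weights $(a_w)_{w\in W}$ averages an eigenspace $\Lambda$ if $\sum_{w\in W}a_w\phi(w)=\frac1n\sum_{v}\phi(v)$ for all $\phi\in\Lambda$. $W$ is a positively weighted extremal design if there are weights $a_w>0$ with which $W$ averages all eigenspaces except the last one. Minimal means inclusion-minimal among positively weighted extremal designs. *)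

(* Defs.v *)
From HB Require Import structures.
From mathcomp Require Import all_boot all_order all_algebra.
From mathcomp Require Import reals.

Set Implicit Arguments.
Unset Strict Implicit.
Unset Printing Implicit Defensive.

Import Order.TTheory GRing.Theory Num.Theory.
Local Open Scope ring_scope.

Definition cycle_graph (n : nat) : rel 'I_n :=
  fun i j => (j == ordS i) || (i == ordS j).

Definition normalized_adjacency (R : realType) (n : nat) (d : nat)
    (e : rel 'I_n) : 'M[R]_n :=
  d%:R^-1 *: \matrix_(i, j) (e i j)%:R.

(* An ordering of the eigenspaces is given by the list of the distinct
   eigenvalues.  The condition on the head only matters when -1 is also an
   eigenvalue (bipartite graphs): it breaks the tie in absolute value. *)
Definition frequency_order (R : realType) (n : nat) (M : 'M[R]_n)
    (s : seq R) : Prop :=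
  [/\ uniq s,
      forall x : R, (x \in s) = eigenvalue M x,
      sorted (fun x y : R => `|y| <= `|x|) s
    & head 0 s = 1].

(* Functions on the vertices are row vectors, and L is a matrix representing
   its row space; only the values of a on W matter. *)
Definition averages (R : realType) (n : nat) (W : {set 'I_n}) (a : 'I_n -> R)
    (L : 'M[R]_n) : Prop :=
  forall phi : 'rV[R]_n, (phi <= L)%MS ->
    \sum_(w in W) a w * phi 0 w = n%:R^-1 * \sum_v phi 0 v.

Definition positive_extremal_design (R : realType) (n : nat) (M : 'M[R]_n)
    (s : seq R) (W : {set 'I_n}) : Prop :=
  exists a : 'I_n -> R,
    (forall w, w \in W -> 0 < a w) /\
    (forall k, (k < (size s).-1)%N -> averages W a (eigenspace M s`_k)).

Definition minimal_positive_extremal_design (R : realType) (n : nat)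
    (M : 'M[R]_n) (s : seq R) (W : {set 'I_n}) : Prop :=
  positive_extremal_design M s W /\
  (forall W' : {set 'I_n}, W' \subset W ->
    positive_extremal_design M s W' -> W' = W).

(* Main.v *)
Require Import Defs.
From HB Require Import structures.
From mathcomp Require Import all_boot all_order all_algebra.
From mathcomp Require Import reals trigo.
From mathcomp Require Import zify ring lra.

(** Extend the weights of a design by zero off [W] and subtract the uniform
    weight [1/n].  The design condition says that this error vector is
    orthogonal to every eigenspace but the last; as the eigenspaces of the
    cycle are orthogonal and complete, this means that the error lies in the
    last eigenspace ([design_last_eigenspace]).

    For odd [n] the eigenvalue of least absolute value is [cos t] with
    [t = 2 * pi * k / n] and [4 * k = n + 1] or [4 * k = n - 1], so that [k]
    is prime to [n] ([last_eigenvalue]).  Its eigenvectors are the vectors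
    [A * cos (t * j) + B * sin (t * j)], and the angles [t * j] run over the
    vertices of a regular [n]-gon.  A positively weighted design is therefore
    the same thing as a linear function on the plane that is at least [- 1/n]
    on the vertices of this polygon, and its support is the set of vertices
    where the inequality is strict.

    A line meets the circle in at most two points, so at most two vertices
    lie off the support ([card_design_zeros]).  If at most one does, the linear
    functions vanishing at that vertex leave a direction in which to move, and
    moving until another weight vanishes gives a design with smaller support
    ([shrink_design]).  Minimal designs thus omit exactly two vertices. *)

Set Implicit Arguments.
Unset Strict Implicit.
Unset Printing Implicit Defensive.

Import Order.TTheory GRing.Theory Num.Theory.
Local Open Scope ring_scope.

Local Notation adj R n := (normalized_adjacency R 2 (@cycle_graph n)).

(** * Trigonometric identities *)

Lemma cos_natmul_2pi (R : realType) (k : nat) : cos (2 * pi * k%:R) = 1 :> R.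
Proof.
have := periodicn (@cosD2pi R) k 0.
rewrite add0r cos0 -[_ *+ k]mulr_natr -[pi *+ 2]mulr_natr => h.
by rewrite (mulrC 2).
Qed.

Lemma cos_neq1 (R : realType) (x : R) : 0 < x < 2 * pi -> cos x != 1.
Proof.
move=> /andP[x0 x1]; apply/eqP => cx.
have s0 : 0 < sin (x / 2) by apply: sin_gt0_pi; lra.
have := cos_mulr2n (x / 2).
have -> : (x / 2) *+ 2 = x by rewrite -mulr_natr; field.
rewrite cos2sin2 cx => h; have : sin (x / 2) ^+ 2 = 0 by lra.
by move/eqP; rewrite sqrf_eq0 gt_eqF.
Qed.

Lemma cos_eq1_sin (R : realType) (x : R) : cos x = 1 -> sin x = 0.
Proof. by move=> h; apply: cos1sin0; rewrite h normr1. Qed.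

Lemma cosB_eq1 (R : realType) (x y : R) :
  cos x = 1 -> cos y = 1 -> cos (x - y) = 1.
Proof. by move=> hx hy; rewrite cosB hx hy (cos_eq1_sin hx) mul0r addr0 mulr1. Qed.

(** The three-term recurrence of the cosine: it makes a sampled cosine an
    eigenvector of the neighbour sum, with eigenvalue [cos t]. *)
Lemma cos_step (R : realType) (t b : R) (m : nat) :
  cos (t * m%:R - b) + cos (t * m.+2%:R - b)
  = 2 * cos t * cos (t * m.+1%:R - b).
Proof.
have -> : t * m%:R - b = (t * m.+1%:R - b) - t by rewrite -[in RHS]natr1; ring.
have -> : t * m.+2%:R - b = (t * m.+1%:R - b) + t.
  by rewrite -[m.+2%:R]natr1; ring.
by move: (t * m.+1%:R - b) => x; rewrite cosB cosD; ring.
Qed.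

(** A cosine whose frequency [t] satisfies [cos (t * n) = 1] lives on the cycle:
    it does not see the reduction modulo [n] in the successor and predecessor
    maps of ['I_n]. *)
Lemma cos_modn (R : realType) (n : nat) (t b : R) (m : nat) :
  cos (t * n%:R) = 1 -> cos (t * (m %% n)%:R - b) = cos (t * m%:R - b).
Proof.
move=> c1; have s0 := cos_eq1_sin c1.
rewrite {2}(divn_eq m n) natrD natrM.
elim: (m %/ n)%N => [|q IH]; first by rewrite mul0r add0r.
rewrite {}IH -natr1.
have -> : t * ((q%:R + 1) * n%:R + (m %% n)%:R) - b
        = (t * (q%:R * n%:R + (m %% n)%:R) - b) + t * n%:R by ring.
by rewrite [RHS]cosD c1 s0 mulr1 mulr0 subr0.
Qed.

Lemma cos_mul_eq1 (R : realType) (x : R) (m : nat) :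
  cos x = 1 -> cos (x * m%:R) = 1.
Proof.
move=> h; have := @cos_modn R 1 x 0 m; rewrite mulr1 modn1 mulr0 !subr0 cos0.
by move/(_ h) => <-.
Qed.

Lemma cos_rootn (R : realType) (n k : nat) : (0 < n)%N ->
  cos (2 * pi * k%:R / n%:R * n%:R : R) = 1.
Proof. by move=> n0; rewrite mulfVK ?cos_natmul_2pi // pnatr_eq0 -lt0n. Qed.

Lemma cos_angle_neq1 (R : realType) (n d : nat) :
  (0 < d < n)%N -> cos (2 * pi * d%:R / n%:R : R) != 1.
Proof.
move=> /andP[d0 dn]; have n0 : 0 < n%:R :> R by rewrite ltr0n; lia.
apply: cos_neq1; apply/andP; split.
  by rewrite divr_gt0 // mulr_gt0 ?ltr0n // mulr_gt0 ?pi_gt0.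
by rewrite ltr_pdivrMr // ltr_pM2l ?ltr_nat // mulr_gt0 ?pi_gt0.
Qed.

(** Distinct vertices are sent by [j |-> t * j] to angles that differ modulo the
    period; this is how the primitivity of the frequency [t] gets used. *)
Lemma cos_dist_neq1 (R : realType) (n : nat) (t : R) (i j : 'I_n) :
  (forall d, (0 < d < n)%N -> cos (t * d%:R) != 1) -> i != j ->
  cos (t * (i : nat)%:R - t * (j : nat)%:R) != 1.
Proof.
move=> h; rewrite -(inj_eq val_inj) /= neq_ltn => /orP[ij|ij]; last first.
  rewrite -mulrBr -natrB ?(ltnW ij) //; apply: h.
  by rewrite subn_gt0 ij (leq_ltn_trans (leq_subr _ _)).
rewrite -cosN opprB -mulrBr -natrB ?(ltnW ij) //; apply: h.
by rewrite subn_gt0 ij (leq_ltn_trans (leq_subr _ _)).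
Qed.

(** Multiplying by [2 * sin (y / 2)] makes the sum telescope to
    [sin (y * n - y / 2) + sin (y / 2)], which vanishes because [y * n] is a
    multiple of the period. *)
Lemma sum_cos_eq0 (R : realType) (n : nat) (y : R) :
  cos (y * n%:R) = 1 -> cos y != 1 -> \sum_(k < n) cos (y * k%:R) = 0.
Proof.
move=> c1 cy; have s0 := cos_eq1_sin c1.
have hy : sin (y / 2) != 0.
  apply: contra_neq cy => h.
  have := cos_mulr2n (y / 2).
  have -> : (y / 2) *+ 2 = y by rewrite -mulr_natr; field.
  by rewrite cos2sin2 h => ->; rewrite expr0n /= subr0 mulr2n addrK.
have tel m : 2 * sin (y / 2) * (\sum_(k < m) cos (y * k%:R))
           = sin (y * m%:R - y / 2) + sin (y / 2).
  elim: m => [|m IH]; first by rewrite big_ord0 mulr0 mulr0 sub0r sinN addNr.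
  rewrite big_ord_recr /= mulrDr {}IH -[m.+1%:R]natr1.
  have -> : y * (m%:R + 1) - y / 2 = y * m%:R + y / 2 by field.
  by rewrite sinB sinD; ring.
apply: (mulfI (x := 2 * sin (y / 2))); first by rewrite mulf_neq0 // pnatr_eq0.
by rewrite tel sinB c1 s0; ring.
Qed.

(** * The adjacency matrix of the cycle and its waves *)

Lemma ord_pred_neqS (n : nat) (j : 'I_n) : (3 <= n)%N -> ord_pred j != ordS j.
Proof.
move=> n3; case: j => -[|j] jn; apply/eqP => /(congr1 val) /=.
  by rewrite add0n !modn_small; lia.
rewrite ?addSn /= modnDr (modn_small (ltnW jn)).
case: (ltnP j.+2 n) => h; first by rewrite modn_small //; lia.
have -> : j.+2 = n by lia.
by rewrite modnn; lia.
Qed.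

Lemma adj_sym (R : realType) (n : nat) : (adj R n)^T = adj R n.
Proof. by apply/matrixP => i j; rewrite !mxE /cycle_graph orbC. Qed.

Lemma mulmx_adj (R : realType) (n : nat) (phi : 'rV[R]_n) (j : 'I_n) :
  (3 <= n)%N ->
  (phi *m adj R n) 0 j = (phi 0 (ord_pred j) + phi 0 (ordS j)) / 2.
Proof.
move=> n3; rewrite -scalemxAr !mxE (bigD1 (ord_pred j)) //=.
rewrite (bigD1 (ordS j)) /=; last by rewrite eq_sym ord_pred_neqS.
rewrite big1 => [|i /andP[ip iS]]; last first.
  rewrite mxE /cycle_graph (negPf iS) -{1}(ord_predK j) (inj_eq (@ordS_inj n)).
  by rewrite eq_sym (negPf ip) mulr0.
rewrite !mxE /cycle_graph ord_predK !eqxx orbT /= addr0.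
by rewrite !mulr1 mulrC.
Qed.

Lemma eigenspace_adjP (R : realType) (n : nat) (mu : R) (phi : 'rV[R]_n) :
  (3 <= n)%N ->
  reflect (forall j, phi 0 (ord_pred j) + phi 0 (ordS j) = 2 * mu * phi 0 j)
          (phi <= eigenspace (adj R n) mu)%MS.
Proof.
move=> n3; apply: (iffP eigenspaceP) => [h j|h].
  have := congr1 (fun v : 'rV__ => v 0 j) h; rewrite mulmx_adj // mxE; lra.
apply/rowP => j; rewrite mulmx_adj // mxE h; lra.
Qed.

(** Cosine waves with an arbitrary phase [b], so that the sine waves are
    included. *)
Definition wave (R : realType) (n : nat) (t b : R) : 'rV[R]_n :=
  \row_j cos (t * (j : nat)%:R - b).

Lemma wave_neq0 (R : realType) (n : nat) (t : R) : (0 < n)%N -> wave n t 0 != 0.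
Proof.
move=> n0; apply/eqP => /rowP/(_ (Ordinal n0)); rewrite !mxE /= mulr0 subr0 cos0.
by move/eqP; rewrite oner_eq0.
Qed.

Lemma wave_eigen (R : realType) (n : nat) (t b : R) :
  (3 <= n)%N -> cos (t * n%:R) = 1 ->
  (wave n t b <= eigenspace (adj R n) (cos t))%MS.
Proof.
move=> n3 c1; apply/eigenspace_adjP => // j; rewrite !mxE /= !cos_modn //.
have shift m : cos (t * m%:R - b) = cos (t * (m + n)%:R - b).
  by rewrite -[RHS](cos_modn _ _ c1) modnDr cos_modn.
rewrite (shift j.+1) (shift j) addSn.
by case: (j + n)%N (leq_addl j n) => [|m _]; [lia | exact: cos_step].
Qed.

(** An eigenvector is a periodic solution of a second order linear recurrence,
    so its first two values determine [A] and [B].  Going once around the cycle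
    says that the rotation of angle [t * n] fixes the vector [(A, B)], which for
    a nonzero vector forces the rotation to be the identity. *)
Lemma eigenvector_adj (R : realType) (n : nat) (t : R) (phi : 'rV[R]_n) :
  (3 <= n)%N -> sin t != 0 -> (phi <= eigenspace (adj R n) (cos t))%MS ->
  exists A B : R,
    (forall j : 'I_n, phi 0 j = A * cos (t * (j : nat)%:R) + B * sin (t * (j : nat)%:R))
    /\ (phi != 0 -> cos (t * n%:R) = 1).
Proof.
move=> n3 st /(eigenspace_adjP _ _ n3) h.
have n0 : (0 < n)%N by lia.
pose f m := phi 0 (Ordinal (ltn_pmod m n0)).
have fE (j : 'I_n) : phi 0 j = f j.
  by congr (phi 0 _); apply: val_inj; rewrite /= modn_small.
have fn m : f (m + n)%N = f m.
  by congr (phi 0 _); apply: val_inj; rewrite /= modnDr.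
have rec m : f m.+2 = 2 * cos t * f m.+1 - f m.
  have := h (Ordinal (ltn_pmod m.+1 n0)); rewrite -/(f m.+1) => <-.
  have -> : phi 0 (ordS (Ordinal (ltn_pmod m.+1 n0))) = f m.+2.
    by congr (phi 0 _); apply: val_inj; rewrite /= -addn1 modnDml addn1.
  have -> : ord_pred (Ordinal (ltn_pmod m.+1 n0)) = Ordinal (ltn_pmod m n0).
    rewrite -[RHS]ordSK; congr ord_pred; apply: val_inj.
    by rewrite /= -[in RHS]addn1 modnDml addn1.
  rewrite -/(f m); lra.
pose A := f 0%N; pose B := (f 1%N - A * cos t) / sin t.
have form m : f m = A * cos (t * m%:R) + B * sin (t * m%:R).
  suff [] : f m = A * cos (t * m%:R) + B * sin (t * m%:R) /\
     f m.+1 = A * cos (t * m.+1%:R) + B * sin (t * m.+1%:R) by [].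
  elim: m => [|m [IH1 IH2]].
    by rewrite !mulr0 mulr1 cos0 sin0 /B /A; split; field.
  split=> //; rewrite rec IH1 IH2.
  have -> : t * m%:R = t * m.+1%:R - t by rewrite -natr1; ring.
  have -> : t * m.+2%:R = t * m.+1%:R + t by rewrite -[m.+2%:R]natr1; ring.
  by rewrite cosB cosD sinB sinD; ring.
exists A, B; split=> [j|nz]; first by rewrite fE form.
pose c := cos (t * n%:R); pose s := sin (t * n%:R).
have e0 : A * c + B * s = A by rewrite -form -[n in f n]add0n fn.
have e1 : - A * s + B * c = B.
  have := fn 1%N; rewrite (form (1 + n)%N) (form 1%N) natrD mulrDr !mulr1.
  rewrite cosD sinD -/c -/s => e; apply: (mulIf st).
  by have /= := congr1 (fun x => x * cos t) e0; move: e; lra.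
have cs : c ^+ 2 + s ^+ 2 = 1 by apply: cos2Dsin2.
have AB : (A ^+ 2 + B ^+ 2) * (1 - c) = 0.
  have /= := congr1 (fun x => x * A) e0; have /= := congr1 (fun x => x * B) e1.
  lra.
move/eqP: AB; rewrite mulf_eq0 => /orP[|]; last by rewrite subr_eq0 => /eqP/esym.
rewrite paddr_eq0 ?sqr_ge0 // !sqrf_eq0 => /andP[/eqP A0 /eqP B0].
by case/eqP: nz; apply/rowP => j; rewrite fE form A0 B0 mxE !mul0r addr0.
Qed.

(** * Orthogonality and completeness of the eigenspaces *)

(** Moving [A] across the bilinear form shows that [l] and [m] multiply the
    pairing of [b] and [phi] to the same value. *)
Lemma eigen_ortho (F : fieldType) (n : nat) (A : 'M[F]_n) (l m : F)
    (b phi : 'rV[F]_n) : A^T = A -> l != m ->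
  (b <= eigenspace A l)%MS -> (phi <= eigenspace A m)%MS ->
  \sum_j b 0 j * phi 0 j = 0.
Proof.
move=> sA lm /eigenspaceP hb /eigenspaceP hp.
have e : l *: (b *m phi^T) = m *: (b *m phi^T).
  by rewrite scalemxAl -hb -mulmxA -{1}sA -trmx_mul hp scalemxAr linearZ.
have : (l - m) * (b *m phi^T) 0 0 = 0.
  by have := congr1 (fun v : 'M__ => v 0 0) e; rewrite !mxE mulrBl => ->; rewrite subrr.
move/eqP; rewrite mulf_eq0 subr_eq0 (negPf lm) /= => /eqP; rewrite mxE => h.
by rewrite -[RHS]h; apply: eq_bigr => j _; rewrite mxE.
Qed.

(** The inner sum over the frequencies [k] is [n] when [x = j] and vanishes
    otherwise by [sum_cos_eq0]. *)
Lemma fourier_inversion (R : realType) (n : nat) (b : 'rV[R]_n) (j : 'I_n) :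
  b 0 j = n%:R^-1 * \sum_(k < n) \sum_x b 0 x *
    cos (2 * pi * k%:R / n%:R * (x : nat)%:R - 2 * pi * k%:R / n%:R * (j : nat)%:R).
Proof.
have n0 : n%:R != 0 :> R by rewrite pnatr_eq0 -lt0n; case: j => j /=; lia.
rewrite exchange_big (bigD1 j) //= [X in _ + X]big1 => [|x xj]; last first.
  rewrite -mulr_sumr; set S := \sum_(k < n) _.
  suff -> : S = 0 by rewrite mulr0.
  pose y : R := 2 * pi / n%:R * (x : nat)%:R - 2 * pi / n%:R * (j : nat)%:R.
  rewrite -(@sum_cos_eq0 R n y); first by apply: eq_bigr => k _; congr cos; rewrite /y; field.
    have -> : y * n%:R = 2 * pi * (x : nat)%:R - 2 * pi * (j : nat)%:R.
      by rewrite /y; field.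
    by rewrite cosB_eq1 // cos_natmul_2pi.
  apply: cos_dist_neq1 xj => d dn.
  have -> : 2 * pi / n%:R * d%:R = 2 * pi * d%:R / n%:R :> R by field.
  exact: cos_angle_neq1.
under eq_bigr do rewrite subrr cos0.
by rewrite sumr_const card_ord addr0 mulr1 -[b 0 j *+ n]mulr_natr mulrCA mulVf ?mulr1.
Qed.

(** This stands in for the spectral theorem.  In the Fourier expansion of [b],
    the component of frequency [k] is an eigenvector for [cos (2 * pi * k / n)],
    and its values are pairings of [b] with waves of that eigenvalue; hence only
    the components with eigenvalue [lam] survive. *)
Lemma mem_eigenspace_adj (R : realType) (n : nat) (lam : R) (b : 'rV[R]_n) :
  (3 <= n)%N ->
  (forall mu (phi : 'rV[R]_n), mu != lam -> (phi <= eigenspace (adj R n) mu)%MS ->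
     \sum_j b 0 j * phi 0 j = 0) ->
  (b <= eigenspace (adj R n) lam)%MS.
Proof.
move=> n3 hb; pose t (k : nat) : R := 2 * pi * k%:R / n%:R.
have ct k : cos (t k * n%:R) = 1 by apply: cos_rootn; lia.
have -> : b = n%:R^-1 *:
    \sum_(k < n) \sum_x b 0 x *: wave n (t k) (t k * (x : nat)%:R).
  apply/rowP => j; rewrite [LHS]fourier_inversion !mxE; congr (_ * _).
  rewrite summxE; apply: eq_bigr => k _; rewrite summxE; apply: eq_bigr => x _.
  by rewrite !mxE -cosN opprB.
apply: scalemx_sub; apply: summx_sub => k _.
have [<-|ne] := eqVneq (cos (t k)) lam.
  by apply: summx_sub => x _; apply: scalemx_sub; apply: wave_eigen.
have -> : \sum_x b 0 x *: wave n (t k) (t k * (x : nat)%:R) = 0.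
  apply/rowP => j; rewrite summxE [RHS]mxE.
  rewrite -[RHS](hb _ _ ne (wave_eigen (t k * (j : nat)%:R) n3 (ct k))).
  by apply: eq_bigr => x _; rewrite !mxE -cosN opprB.
exact: sub0mx.
Qed.

(** * The last eigenvalue *)

Lemma last_le_norm (R : realType) (s : seq R) (x : R) :
  sorted (fun x y : R => `|y| <= `|x|) s -> x \in s -> `|last 0 s| <= `|x|.
Proof.
case: s => [//|y s] /= hs xs.
elim: s y x hs xs => [|z s IH] y x /=; first by rewrite inE => _ /eqP ->.
move=> /andP[zy hs]; rewrite inE => /orP[/eqP ->|]; last exact: IH.
by apply: (le_trans _ zy); apply: (IH z z); rewrite ?mem_head.
Qed.

(** The frequencies [t] with [cos (t * n) = 1] are [2 * pi / n] apart. *)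
Lemma cos_root_unique (R : realType) (n : nat) (t t0 : R) :
  cos (t * n%:R) = 1 -> cos (t0 * n%:R) = 1 ->
  `|t - t0| * n%:R < 2 * pi -> (0 < n)%N -> t = t0.
Proof.
move=> c c0 h n0; apply/eqP; rewrite -subr_eq0 -normr_eq0; apply: contraT => nz.
have /cos_neq1/eqP[] : 0 < `|t - t0| * n%:R < 2 * pi.
  by rewrite h andbT mulr_gt0 ?ltr0n // lt_def nz normr_ge0.
rewrite -[n%:R in LHS]ger0_norm // -normrM cos_norm mulrBl.
exact: cosB_eq1.
Qed.

(** The bound [sin e] is the absolute value of the cosine at both ends of
    the interval of radius [e] around [pi / 2], and cosine decreases there. *)
Lemma acos_near_pihalf (R : realType) (x e : R) :
  0 < e < pi / 2 -> `|x| <= sin e ->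
  [/\ cos (acos x) = x, pi / 2 - e <= acos x & acos x <= pi / 2 + e].
Proof.
move=> /andP[e0 e1] /[dup] xe /le_trans/(_ (sin_le1 e)); rewrite !ler_norml in xe *.
move=> x1; move/andP: xe => [xa xb].
have cx : cos (acos x) = x by apply: acosK; rewrite in_itv.
have rng : acos x \in `[0, pi] by rewrite in_itv /= acos_ge0 ?acos_lepi.
have pi0 := pi_gt0 R.
split=> //; rewrite leNgt; apply/negP => h.
  have : cos (pi / 2 - e) < cos (acos x).
    by rewrite ltr_cos //; rewrite in_itv /=; apply/andP; split; lra.
  by rewrite cx -cosN opprB cosBpihalf; lra.
have : cos (acos x) < cos (pi / 2 + e).
  by rewrite ltr_cos //; rewrite in_itv /=; apply/andP; split; lra.
by rewrite cx addrC cosDpihalf; lra.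
Qed.

(** For odd [n] exactly one of [n - 1] and [n + 1] is a multiple of 4; the
    corresponding [k] gives the admissible frequency closest to a right angle. *)
Lemma quarter_angle (R : realType) (n k : nat) : (3 <= n)%N ->
  (4 * k = n + 1 \/ 4 * k + 1 = n)%N ->
  let t0 : R := 2 * pi * k%:R / n%:R in let e : R := pi / (2 * n%:R) in
  (t0 = pi / 2 + e \/ t0 = pi / 2 - e).
Proof.
move=> n3 hk /=; have n0 : n%:R != 0 :> R by rewrite pnatr_eq0; lia.
case: hk => hk; [left|right].
  have -> : k%:R = (n%:R + 1) / 4 :> R.
    have := congr1 (fun m : nat => m%:R : R) hk; rewrite natrM natrD; lra.
  by field.
have -> : k%:R = (n%:R - 1) / 4 :> R.
  have := congr1 (fun m : nat => m%:R : R) hk; rewrite natrD natrM; lra.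
by field.
Qed.

(** Multiplying the frequency by 4 turns it into [2 * pi / n] up to sign and a
    multiple of [2 * pi]: 4 is, up to sign, an inverse of [k] modulo [n]. *)
Lemma quarter_angle_primitive (R : realType) (n k d : nat) :
  (4 * k = n + 1 \/ 4 * k + 1 = n)%N -> (0 < d < n)%N ->
  cos (2 * pi * k%:R / n%:R * d%:R : R) != 1.
Proof.
move=> hk dn; apply/eqP => /(cos_mul_eq1 4) h.
have n0 : n%:R != 0 :> R by rewrite pnatr_eq0; lia.
have /eqP[] := cos_angle_neq1 R dn.
have h2 := cos_natmul_2pi R d.
case: hk => hk.
  have -> : 2 * pi * d%:R / n%:R
     = 2 * pi * k%:R / n%:R * d%:R * 4%:R - 2 * pi * d%:R :> R.
    have -> : k%:R = (n%:R + 1) / 4 :> R.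
      have := congr1 (fun m : nat => m%:R : R) hk; rewrite natrM natrD; lra.
    by field.
  exact: cosB_eq1.
have -> : 2 * pi * d%:R / n%:R
   = 2 * pi * d%:R - 2 * pi * k%:R / n%:R * d%:R * 4%:R :> R.
  have -> : k%:R = (n%:R - 1) / 4 :> R.
    have := congr1 (fun m : nat => m%:R : R) hk; rewrite natrD natrM; lra.
  by field.
exact: cosB_eq1.
Qed.

(** The eigenvalue of least absolute value belongs to the frequency closest to
    [pi / 2].  Being at least as small as the cosine of the quarter angle, it has
    its own angle within [pi / (2 * n)] of [pi / 2], hence within [pi / n] of the
    quarter angle, and the spacing [2 * pi / n] of the frequencies makes the two
    equal. *)
Lemma last_eigenvalue (R : realType) (n : nat) (s : seq R) :
  (3 <= n)%N -> odd n -> frequency_order (adj R n) s ->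
  exists t : R, [/\ 0 < t < pi, last 0 s = cos t, cos (t * n%:R) = 1 &
    forall d, (0 < d < n)%N -> cos (t * d%:R) != 1].
Proof.
move=> n3 nodd [us es ss hd].
(* Rounding [n / 4] to the nearest integer. *)
have [k hk] : exists k, (4 * k = n + 1 \/ 4 * k + 1 = n)%N.
  exists ((n + 1) %/ 4)%N; have := odd_double_half n; rewrite nodd.
  by move: n./2 => m; lia.
pose t0 : R := 2 * pi * k%:R / n%:R; pose e : R := pi / (2 * n%:R).
have n0 : 0 < n%:R :> R by rewrite ltr0n; lia.
have n3' : 3 <= n%:R :> R by rewrite (ler_nat R 3).
have pi0 := pi_gt0 R.
have ht0 : t0 = pi / 2 + e \/ t0 = pi / 2 - e by apply: quarter_angle.
have en : e * n%:R = pi / 2 by rewrite /e; field; lra.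
have e0 : 0 < e by rewrite divr_gt0 // mulr_gt0.
have e1 : e < pi / 2.
  have : 0 < e * (n%:R - 1) by apply: mulr_gt0; lra.
  by rewrite mulrBr en; lra.
have ct0 : cos (t0 * n%:R) = 1 by apply: cos_rootn; lia.
have nct : `|cos t0| = sin e.
  have se : 0 <= sin e by apply: sin_ge0_pi; lra.
  case: ht0 => ->; first by rewrite addrC cosDpihalf normrN ger0_norm.
  by rewrite -cosN opprB cosBpihalf ger0_norm.
have t0s : cos t0 \in s.
  rewrite es; apply/eigenvalueP; exists (wave n t0 0); last by apply: wave_neq0; lia.
  by apply/eigenspaceP; apply: wave_eigen.
have := last_le_norm ss t0s; rewrite nct => hl.
have ls : last 0 s \in s by case: (s) t0s => [//|y s' _] /=; apply: mem_last.
have e01 : 0 < e < pi / 2 by rewrite e0.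
have [cl lo hi] := acos_near_pihalf e01 hl.
move: (acos (last 0 s)) cl lo hi => t cl lo hi.
have tpi : 0 < t < pi by lra.
have ct : cos (t * n%:R) = 1.
  move: ls; rewrite es => /eigenvalueP[v /eigenspaceP vl v0].
  have st : sin t != 0 by rewrite gt_eqF // sin_gt0_pi.
  rewrite -cl in vl.
  by have [A [B [_]]] := eigenvector_adj n3 st vl; apply.
have tt : t = t0.
  apply: (cos_root_unique ct ct0) (ltnW (ltnW n3)).
  have : `|t - t0| <= 2 * e by rewrite ler_norml; case: ht0 => ->; lra.
  by move/(ler_wpM2r (ltW n0)); lra.
exists t; split=> // d dn; rewrite tt; exact: quarter_angle_primitive.
Qed.

(** * Designs as vectors of the last eigenspace *)

(** The weights, extended by zero off [W], minus the uniform weight.  A vertex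
    is outside the support precisely where this vector equals [- n^-1]. *)
Definition design_error (R : realType) (n : nat) (W : {set 'I_n})
    (a : 'I_n -> R) : 'rV[R]_n :=
  \row_j ((if j \in W then a j else 0) - n%:R^-1).

Lemma averages_error (R : realType) (n : nat) (W : {set 'I_n})
    (a : 'I_n -> R) (L : 'M[R]_n) :
  averages W a L <-> forall phi : 'rV[R]_n, (phi <= L)%MS ->
    \sum_j design_error W a 0 j * phi 0 j = 0.
Proof.
have e (phi : 'rV[R]_n) : \sum_j design_error W a 0 j * phi 0 j =
    \sum_(w in W) a w * phi 0 w - n%:R^-1 * \sum_v phi 0 v.
  rewrite [\sum_(w in W) _]big_mkcond mulr_sumr -sumrB; apply: eq_bigr => j _.
  by rewrite mxE mulrBl; case: ifP; rewrite ?mul0r.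
split=> h phi pL; first by rewrite e h // subrr.
by apply/eqP; rewrite -subr_eq0 -e h.
Qed.

(** Averaging an eigenspace means that the error is orthogonal to it, and the
    eigenspaces are mutually orthogonal and complete; so averaging all but one of
    them puts the error in the remaining one. *)
Lemma design_last_eigenspace (R : realType) (n : nat) (s : seq R)
    (W : {set 'I_n}) (a : 'I_n -> R) :
  (3 <= n)%N -> frequency_order (adj R n) s ->
  (forall k, (k < (size s).-1)%N -> averages W a (eigenspace (adj R n) s`_k))
  <-> (design_error W a <= eigenspace (adj R n) (last 0 s))%MS.
Proof.
move=> n3 [us es _ _]; rewrite -nth_last; split=> [h|h k ks].
  apply: mem_eigenspace_adj => // mu phi ml pm.
  have [->|p0] := eqVneq phi 0; first by rewrite big1 // => j _; rewrite !mxE mulr0.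
  have : mu \in s by rewrite es; apply/eigenvalueP; exists phi => //; apply/eigenspaceP.
  move=> mus; have e := nth_index 0 mus; rewrite -e in pm ml.
  have /averages_error : averages W a (eigenspace (adj R n) s`_(index mu s)).
    apply: h; rewrite ltn_neqAle.
    have ilt : (index mu s < size s)%N by rewrite index_mem.
    have -> : (index mu s <= (size s).-1)%N by rewrite -ltnS (ltn_predK ilt).
    by rewrite andbT; apply: contraNneq ml => ->.
  exact.
apply/averages_error => phi pk; apply: eigen_ortho h pk; first exact: adj_sym.
have kl : (k < size s)%N := leq_trans ks (leq_pred _).
by rewrite nth_uniq ?gtn_eqF // (ltn_predK kl).
Qed.

(** * The size of the complement of a minimal design *)

(** The points of angles [p], [q], [r] lie on a common line that misses the
    origin, so the triangle they span has area zero ([cross0]).  For points of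
    the unit circle this area is expressed by [p - q] and [q - r] alone, and its
    vanishing forces two of the points to coincide. *)
Lemma line_meets_circle (R : realType) (A B c p q r : R) : c != 0 ->
  A * cos p + B * sin p = c -> A * cos q + B * sin q = c ->
  A * cos r + B * sin r = c ->
  cos (p - q) != 1 -> cos (q - r) != 1 -> cos (p - r) = 1.
Proof.
move=> c0 hp hq hr npq nqr.
have cross0 : (cos p - cos q) * (sin q - sin r)
            - (cos q - cos r) * (sin p - sin q) = 0.
  set X := LHS.
  have e1 : A * (cos p - cos q) + B * (sin p - sin q) = 0 by lra.
  have e2 : A * (cos q - cos r) + B * (sin q - sin r) = 0 by lra.
  have hA : A * X = 0.
    transitivity ((A * (cos p - cos q) + B * (sin p - sin q)) * (sin q - sin r)
      - (A * (cos q - cos r) + B * (sin q - sin r)) * (sin p - sin q)).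
      by rewrite /X; ring.
    by rewrite e1 e2 !mul0r subrr.
  have hB : B * X = 0.
    transitivity ((A * (cos q - cos r) + B * (sin q - sin r)) * (cos p - cos q)
      - (A * (cos p - cos q) + B * (sin p - sin q)) * (cos q - cos r)).
      by rewrite /X; ring.
    by rewrite e1 e2 !mul0r subrr.
  apply/eqP; apply: contraT => X0.
  move/eqP: hA; rewrite mulf_eq0 (negPf X0) orbF => /eqP A0.
  move/eqP: hB; rewrite mulf_eq0 (negPf X0) orbF => /eqP B0.
  by move: c0; rewrite -hp A0 B0 !mul0r addr0 eqxx.
have hx := cos2Dsin2 (p - q); have hy := cos2Dsin2 (q - r).
have sum0 : sin (p - q) * (1 - cos (q - r)) + sin (q - r) * (1 - cos (p - q)) = 0.
  have spr : sin (p - r) = sin (p - q) * cos (q - r) + cos (p - q) * sin (q - r).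
    by rewrite -sinD addrA subrK.
  transitivity (sin (p - q) + sin (q - r) - sin (p - r)).
    by rewrite spr; ring.
  by rewrite !sinB; move: cross0; lra.
have -> : p - r = (p - q) + (q - r) by ring.
rewrite cosD.
move: npq nqr hx hy sum0; rewrite -subr_eq0 -[cos (q - r) == 1]subr_eq0.
move: (cos (p - q)) (sin (p - q)) (cos (q - r)) (sin (q - r)) => a b x y na nx h1 h2 h3.
(* [b] and [y] are eliminated by squaring [sum0]. *)
have e : (a - 1) * (x - 1) * (2 * (a - x)) = 0.
  have e1 : (b * (1 - x)) ^+ 2 = (y * (1 - a)) ^+ 2.
    have -> : b * (1 - x) = - (y * (1 - a)) by lra.
    by rewrite sqrrN.
  have -> : (a - 1) * (x - 1) * (2 * (a - x))
      = (1 - a ^+ 2) * (1 - x) ^+ 2 - (1 - x ^+ 2) * (1 - a) ^+ 2 by ring.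
  have -> : 1 - a ^+ 2 = b ^+ 2 by lra.
  have -> : 1 - x ^+ 2 = y ^+ 2 by lra.
  by rewrite -!exprMn e1 subrr.
have ax : a = x.
  by move/eqP: e; rewrite !mulf_eq0 (negPf na) (negPf nx) pnatr_eq0 /= subr_eq0 => /eqP.
subst x.
(* The cosines agree and the sines are opposite: the two rotations cancel. *)
have : (b + y) * (a - 1) = 0 by lra.
move/eqP; rewrite mulf_eq0 (negPf na) orbF => /eqP by0.
have -> : y = - b by lra.
by rewrite -h1; ring.
Qed.

(** On the complement of [W] the error is the constant [- n^-1]; so the vertices
    there, placed on the unit circle at the angles [t * j], lie on one line. *)
Lemma card_design_zeros (R : realType) (n : nat) (t : R) (W : {set 'I_n})
    (a : 'I_n -> R) : (3 <= n)%N -> sin t != 0 ->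
  (forall d, (0 < d < n)%N -> cos (t * d%:R) != 1) ->
  (design_error W a <= eigenspace (adj R n) (cos t))%MS -> (#|~: W| <= 2)%N.
Proof.
move=> n3 st prim /(eigenvector_adj n3 st) [A [B [h _]]].
rewrite leqNgt; apply/negP => /card_gt2P [i [j [k [[iW jW kW] [ij jk ki]]]]].
have zero l : l \in ~: W ->
    A * cos (t * (l : nat)%:R) + B * sin (t * (l : nat)%:R) = - n%:R^-1.
  by rewrite inE -h mxE => /negPf ->; rewrite sub0r.
have c0 : - n%:R^-1 != 0 :> R by rewrite oppr_eq0 invr_eq0 pnatr_eq0; lia.
have := line_meets_circle c0 (zero _ iW) (zero _ jW) (zero _ kW)
  (cos_dist_neq1 prim ij) (cos_dist_neq1 prim jk).
by apply/eqP; apply: cos_dist_neq1 prim _; rewrite eq_sym.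
Qed.

(** Moving the weights along [d], the first weight to vanish is at the minimiser
    of [- a j / d j] among the decreasing coordinates. *)
Lemma first_zero (R : realFieldType) (I : finType) (W : {set I}) (a d : I -> R) (i : I) :
  i \in W -> d i < 0 -> (forall j, j \in W -> 0 < a j) ->
  exists u : R, (forall j, j \in W -> 0 <= a j + u * d j) /\
    exists2 k, k \in W & a k + u * d k = 0.
Proof.
move=> iW di apos.
pose P j := (j \in W) && (d j < 0).
have Pi : P i by rewrite /P iW.
case: (arg_minP (P := P) (fun j => - a j / d j) Pi) => k /andP[kW dk] kmin.
exists (- a k / d k); split; last by exists k => //; rewrite mulfVK ?subrr ?lt_eqF // addrN.
move=> j jW; have aj := apos _ jW; have ak := apos _ kW.
have u0 : 0 < - a k / d k by rewrite mulNr -mulrN -invrN divr_gt0 // oppr_gt0.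
have [dj|dj] := ltP (d j) 0; last by apply: addr_ge0; [exact: ltW|rewrite mulr_ge0 // ltW].
have := kmin j; rewrite /P jW dj => /(_ isT).
by rewrite -(ler_nM2r dj) mulfVK ?lt_eqF // -subr_ge0 opprK addrC.
Qed.

(** With at most one vertex [j0] missing from [W], the sine wave vanishing at
    [j0] moves the error inside the two-dimensional eigenspace without touching
    the complement of [W].  It takes the value [- sin t < 0] at the predecessor
    of [j0], so some positive weight can be driven to zero. *)
Lemma shrink_design (R : realType) (n : nat) (t : R) (W : {set 'I_n})
    (a : 'I_n -> R) : (3 <= n)%N -> 0 < t < pi -> cos (t * n%:R) = 1 ->
  (forall w, w \in W -> 0 < a w) ->
  (design_error W a <= eigenspace (adj R n) (cos t))%MS ->
  (#|~: W| <= 1)%N ->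
  exists (W' : {set 'I_n}) (a' : 'I_n -> R),
    [/\ W' \proper W, forall w, w \in W' -> 0 < a' w &
       (design_error W' a' <= eigenspace (adj R n) (cos t))%MS].
Proof.
move=> n3 tpi c1 apos hE cW.
have n0 : (0 < n)%N by lia.
have [j0 hj0] : exists j0, ~: W \subset [set j0].
  have [->|[j0 j0W]] := set_0Vmem (~: W); first by exists (Ordinal n0); apply: sub0set.
  by exists j0; apply/subsetP => j jW; rewrite inE; apply/eqP/(card_le1_eqP cW).
have inW j : j != j0 -> j \in W.
  by apply: contraR => jW; rewrite -in_set1; apply: (subsetP hj0); rewrite inE.
(* The phase [pi / 2] turns the cosine into [sin (t * (j - j0))]. *)
pose v := wave n t (t * (j0 : nat)%:R + pi / 2); pose d j := v 0 j.
have vE : (v <= eigenspace (adj R n) (cos t))%MS by apply: wave_eigen.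
have dj0 : d j0 = 0.
  by rewrite /d mxE opprD addrA subrr sub0r cosN cos_pihalf.
have dpred : d (ord_pred j0) < 0.
  have s0 := sin_gt0_pi tpi.
  rewrite /d mxE /= cos_modn //.
  have -> : t * (j0 + n).-1%:R = t * (j0 : nat)%:R - t + t * n%:R.
    have -> : (j0 + n).-1%:R = (j0 : nat)%:R + n%:R - 1 :> R.
      by rewrite -natrD -[in RHS](@prednK (j0 + n)) ?addn_gt0 ?n0 ?orbT // -natr1 addrK.
    by ring.
  have -> : t * (j0 : nat)%:R - t + t * n%:R - (t * (j0 : nat)%:R + pi / 2)
     = t * n%:R - (t + pi / 2) by ring.
  by rewrite cosB c1 (cos_eq1_sin c1) cosDpihalf; lra.
have predW : ord_pred j0 \in W.
  by apply: inW; apply/eqP => e; move: dpred; rewrite e dj0 ltxx.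
have [u [upos [k kW uk]]] := first_zero predW dpred apos.
pose a' j := a j + u * d j; exists [set j in W | 0 < a' j], a'; split.
- apply/properP; split; first by apply/subsetP => j; rewrite inE => /andP[].
  by exists k => //; rewrite inE /a' uk ltxx andbF.
- by move=> w; rewrite inE => /andP[].
have -> : design_error [set j in W | 0 < a' j] a' = design_error W a + u *: v.
  apply/rowP => j; rewrite [LHS]mxE [RHS]mxE [X in _ = X + _]mxE.
  rewrite [X in _ = _ + X]mxE -/(d j) inE.
  have [jW|jW] /= := boolP (j \in W).
    have := upos j jW; rewrite -/(a' j) le_eqVlt eq_sym => /orP[/eqP z|p].
      by rewrite z ltxx addrAC -/(a' j) z.
    by rewrite p addrAC.
  have -> : j = j0 by apply/eqP; apply: contraNT jW; apply: inW.
  by rewrite dj0 mulr0 addr0.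
by apply: addmx_sub => //; apply: scalemx_sub.
Qed.

Theorem theorem4p7 (R : realType) (n : nat) (hn3 : (3 <= n)%N) (hodd : odd n)
    (s : seq R)
    (hs : frequency_order (normalized_adjacency R 2 (@cycle_graph n)) s)
    (W : {set 'I_n})
    (hW : minimal_positive_extremal_design
            (normalized_adjacency R 2 (@cycle_graph n)) s W) :
  #|W| = (n - 2)%N.
Proof.
have [t [tpi lt ct prim]] := last_eigenvalue hn3 hodd hs.
have [[a [apos /(design_last_eigenspace _ _ hn3 hs)]]] := hW.
rewrite lt => hE Wmin.
have st : sin t != 0 by rewrite gt_eqF // sin_gt0_pi.
have c2 := card_design_zeros hn3 st prim hE.
have := cardsC W; rewrite card_ord => cn.
suff : (1 < #|~: W|)%N by lia.
rewrite ltnNge; apply/negP => /(shrink_design hn3 tpi ct apos hE).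
move=> [W' [a' [W'W a'pos]]]; rewrite -lt => /(design_last_eigenspace _ _ hn3 hs) des.
have e : W' = W by apply: Wmin; [exact: proper_sub | exists a'].
by move: W'W; rewrite e properxx.
Qed.
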